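(* Consider the controlled system $$x_{k+1}=f(x_k,\,r_0+u_k),\qquad k\ge 0,$$ where, for given $\varepsilon>0$ with $\varepsilon<\frac{|p_i-p_j|}{2}$ for all $i\neq j$, the control is $$u_k=\begin{cases}\beta_i\,(x_k-p_i) & \text{if } |x_k-p_i|\le\varepsilon \text{ for some } i,\ 1\le i\le m,\\ 0 & \text{otherwise,}\end{cases}$$ with $\beta_i\in(\beta_i^{\inf},\beta_i^{\sup})$ for $1\le i\le m$, and let $\beta=\max_{1\le i\le m}|\beta_i|$. Let $\delta>0$ be given. Then there exists $\varepsilon_0$ with $$0<\varepsilon_0<\min_{i\neq j}\Big\{\frac{|p_i-p_j|}{2};\ \frac{\delta}{\beta}\Big\}$$ such that for all $\varepsilon$ with $0<\varepsilon<\varepsilon_0$, and for almost every initial condition $x_0\in\mathcal{B}$, one has $|u_k|\le\delta$ for all $k$, and $(x_k)_{k\ge1}$ converges to the $m$-periodic orbit $\{p_1,\dots,p_m\}$.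
   Context: Setting: $f(x,r)$ is a real-valued, continuously differentiable function of the real state $x$ and the real scalar parameter $r$. For the nominal value $r=r_0$ the uncontrolled system $x_{k+1}=f(x_k,r_0)$ is chaotic, with a strange attractor $\mathcal{A}$ contained in its basin of attraction $\mathcal{B}\subset\mathbb{R}$. The set $\{p_1,\dots,p_m\}$ is an unstable periodic orbit (UPO) of period $m$ of the uncontrolled system, embedded in the attractor: the $p_i$ are distinct and $p_{i+1}=f(p_i,r_0)$, with indices taken modulo $m$ in $\{1,\dots,m\}$. Standing ergodicity assumption: for almost every initial condition $x_0\in\mathcal{B}$, the trajectory of the uncontrolled system visits every neighborhood of every point of the UPO. Notation: for $\beta_i\in\mathbb{R}$, $f_{\beta_i}(x)=f(x,\,r_0+\beta_i(x-p_i))$. It is assumed that for each $i$, $1\le i\le m$, there is an open interval $(\beta_i^{\inf},\beta_i^{\sup})$ of values $\beta_i$ for which $|f_{\beta_i}'(p_i)|<1$. Conventions: $\delta$ is the maximal allowed parameter perturbation; $\delta/\beta$ is read as $+\infty$ if $\beta=0$, and for $m=1$ the conditions on $|p_i-p_j|$ are void. Convergence of $(x_k)$ to the periodic orbit means that for some index $s$, $|x_k-p_{(s+k)\,\mathrm{mod}(m)}|\to0$ as $k\to\infty$. *)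

(* Defs.v *)
From HB Require Import structures.
From mathcomp Require Import all_boot all_order all_algebra.
From mathcomp Require Import all_classical all_reals all_analysis.

Set Implicit Arguments.
Unset Strict Implicit.
Unset Printing Implicit Defensive.

Import Order.TTheory GRing.Theory Num.Theory.
Import numFieldNormedType.Exports.

Local Open Scope classical_set_scope.
Local Open Scope ring_scope.

(* The residue of [n] modulo [m]: points of an m-periodic orbit are indexed by
   0, ..., m-1 instead of 1, ..., m. *)
Definition ord_mod (m : nat) (hm : (0 < m)%N) (n : nat) : 'I_m :=
  Ordinal (ltn_pmod n hm).

Section Dynamics.
Context {R : realType}.

(* Class C^1 on the plane: Fréchet differentiable everywhere, with
   z |-> 'D_v F z continuous for each direction v (in finite dimension this is
   continuity of the derivative). *)
Definition continuously_differentiable (F : R * R -> R) : Prop :=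
  (forall z, differentiable F z) /\ (forall v, continuous (fun z => 'D_v F z)).

Definition basin_of_attraction (g : R -> R) (A : set R) : set R :=
  [set x | forall e : R, 0 < e ->
     \forall k \near \oo, exists2 a, A a & `|iter k g x - a| < e].

Definition sensitive_on (g : R -> R) (A : set R) : Prop :=
  exists2 c : R, 0 < c & forall x, A x -> forall e : R, 0 < e ->
    exists y k, [/\ A y, `|x - y| < e & c < `|iter k g x - iter k g y|].

Definition transitive_on (g : R -> R) (A : set R) : Prop :=
  forall U V : set R, open U -> open V -> A `&` U !=set0 -> A `&` V !=set0 ->
    exists k x, [/\ A x, U x & V (iter k g x)].

Definition chaotic_on (g : R -> R) (A : set R) : Prop :=
  sensitive_on g A /\ transitive_on g A.

(* "Strange" means that the dynamics on the attractor is chaotic. The basin is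
   only required to have positive measure, not to be a neighbourhood of A, so
   that for instance [0, 1] is allowed for the map 4x(1-x) on the line. *)
Definition strange_attractor (g : R -> R) (A : set R) : Prop :=
  [/\ A !=set0, compact A, g @` A = A,
      ~ (@lebesgue_measure R).-negligible (basin_of_attraction g A)
    & chaotic_on g A].

Section Orbit.
Context {m : nat} (hm : (0 < m)%N).

Definition periodic_orbit (g : R -> R) (p : 'I_m -> R) : Prop :=
  injective p /\ forall i : 'I_m, p (ord_mod hm i.+1) = g (p i).

Definition stable_orbit (g : R -> R) (p : 'I_m -> R) : Prop :=
  forall e : R, 0 < e -> exists2 d : R, 0 < d &
    forall (i : 'I_m) x, `|x - p i| < d ->
      forall k, `|iter k g x - p (ord_mod hm (i + k))| < e.

(* Unstable in the sense of Lyapunov; this covers the orbits whose multiplier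
   has modulus larger than 1. *)
Definition unstable_periodic_orbit (g : R -> R) (p : 'I_m -> R) : Prop :=
  periodic_orbit g p /\ ~ stable_orbit g p.

Definition converges_to_orbit (x : nat -> R) (p : 'I_m -> R) : Prop :=
  exists s : nat, (fun k => `|x k - p (ord_mod hm (s + k))|) @ \oo --> (0 : R).

End Orbit.

(* f_b near the point q, that is, f_{beta_i} for b = beta_i and q = p_i. *)
Definition feedback_map (f : R * R -> R) (r0 q b : R) (x : R) : R :=
  f (x, r0 + b * (x - q)).

(* The index picked is unique as soon as eps < `|p i - p j| / 2 for i != j. *)
Definition control {m : nat} (p beta : 'I_m -> R) (eps x : R) : R :=
  if [pick i | `|x - p i| <= eps] is Some i then beta i * (x - p i) else 0.

Definition controlled_trajectory {m : nat} (f : R * R -> R) (r0 : R)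
    (p beta : 'I_m -> R) (eps x0 : R) (k : nat) : R :=
  iter k (fun x => f (x, r0 + control p beta eps x)) x0.

Definition max_gain {m : nat} (beta : 'I_m -> R) : R :=
  \big[Num.max/0]_(i < m) `|beta i|.

(* min over i != j of `|p i - p j| / 2 and delta / b, in \bar R: for m = 1 the
   inner minimum is +oo, and for b = 0 < delta the quotient is +oo. *)
Definition radius_bound {m : nat} (p : 'I_m -> R) (delta b : R) : \bar R :=
  Order.min
    (\big[Order.min/+oo%E]_(ij : 'I_m * 'I_m | ij.1 != ij.2)
        (`|p ij.1 - p ij.2| / 2)%:E)
    (delta%:E / b%:E)%E.

End Dynamics.

(* Main.v *)
Require Import Defs.
From mathcomp Require Import all_boot all_order all_algebra.
From mathcomp Require Import all_classical all_reals all_analysis.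
From mathcomp Require Import zify lra.
Import Order.TTheory GRing.Theory Num.Theory.
Import numFieldNormedType.Exports.
Local Open Scope classical_set_scope.
Local Open Scope ring_scope.

(** The proof combines local linear stability with ergodicity.

    Inside the window [`|x - p i| <= eps] the controlled map coincides with the
    feedback map of index [i], which sends [p i] to the next point of the orbit
    and has a derivative of modulus less than 1 at [p i].  Differentiability at
    [p i] alone then makes it shrink the distance to the orbit by a fixed factor
    [c < 1], provided that the window is small; as there are finitely many
    points, one [c] and one bound on [eps] serve all of them
    ([contracting_feedback]).  Hence a trajectory that enters a window jumps from
    window to window along the orbit, and its distance to the orbit decays
    geometrically ([captured_converges]).

    Outside the windows the control vanishes.  The controlled trajectory is thus
    the uncontrolled one until its first entrance in a window, and the
    ergodicity assumption says that for almost every initial condition in the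
    basin this entrance occurs ([controlled_enters]).

    The bound on the control holds at every point of the line: it is zero
    outside the windows, and inside it is at most [max_gain beta * eps], which
    [eps < delta / max_gain beta] keeps below [delta] ([control_le]). *)

(** * The radius of the windows *)

Lemma max_gain_ge {R : realType} {m : nat} (beta : 'I_m -> R) i :
  `|beta i| <= max_gain beta.
Proof. exact: le_bigmax. Qed.

Lemma max_gain_ge0 {R : realType} {m : nat} (beta : 'I_m -> R) :
  0 <= max_gain beta.
Proof. exact: bigmax_ge_id. Qed.

Lemma near_right_lt_ereal {R : realType} (y : \bar R) :
  (0 < y)%E -> \forall e \near 0^'+, (e%:E < y)%E.
Proof.
case: y => [r| |] // y0; last by near=> e; rewrite ltry.
by near=> e; rewrite lte_fin; near: e; apply: nbhs_right_lt; rewrite -lte_fin.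
Unshelve. all: by end_near. Qed.

Lemma radius_bound_gt0 {R : realType} {m : nat} (p : 'I_m -> R) (delta b : R) :
  injective p -> 0 < delta -> 0 <= b -> (0 < radius_bound p delta b)%E.
Proof.
move=> p_inj delta0 b0; rewrite /radius_bound lt_min; apply/andP; split.
  apply: lt_bigmin => // -[i j] /= ij.
  by rewrite lte_fin divr_gt0// normr_gt0 subr_eq0 (inj_eq p_inj).
move: b0; rewrite le_eqVlt => /predU1P[<-|b0].
  by rewrite inve0 gt0_muley ?lte_fin.
by rewrite inver gt_eqF// -EFinM lte_fin divr_gt0.
Qed.

Lemma lt_radius_bound {R : realType} {m : nat} (p : 'I_m -> R)
    (delta b eps : R) :
  0 < delta -> 0 <= b -> (eps%:E < radius_bound p delta b)%E ->
  (forall i j, i != j -> eps < `|p i - p j| / 2) /\ b * eps <= delta.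
Proof.
move=> delta0 b0; rewrite /radius_bound lt_min => /andP[eps_sep eps_delta].
split=> [i j ij|].
  rewrite -lte_fin; apply: lt_le_trans eps_sep _.
  exact: (bigmin_le_cond _ (j := (i, j))).
move: b0; rewrite le_eqVlt => /predU1P[<-|b0]; first by rewrite mul0r ltW.
move: eps_delta; rewrite inver gt_eqF// -EFinM lte_fin ltr_pdivlMr// mulrC.
exact: ltW.
Qed.

(** * The control *)

Lemma control_le {R : realType} {m : nat} (p beta : 'I_m -> R) (eps x : R) :
  0 <= eps -> `|control p beta eps x| <= max_gain beta * eps.
Proof.
move=> eps0; rewrite /control; case: pickP => [i xi|_].
  by rewrite normrM ler_pM// max_gain_ge.
by rewrite normr0 mulr_ge0// max_gain_ge0.
Qed.

(** Two windows that met would have centres at distance at most [2 * eps], so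
    the index picked by [control] can only be [i]. *)
Lemma control_in {R : realType} {m : nat} (p beta : 'I_m -> R) (eps x : R) i :
  (forall i j, i != j -> eps < `|p i - p j| / 2) ->
  `|x - p i| <= eps -> control p beta eps x = beta i * (x - p i).
Proof.
move=> eps_sep xi; rewrite /control; case: pickP => [j xj|/(_ i)]; last first.
  by rewrite xi.
have [->//|/eps_sep] := eqVneq j i.
have := ler_distD x (p j) (p i); rewrite (distrC (p j) x).
by move: xi xj; lra.
Qed.

Lemma control_out {R : realType} {m : nat} (p beta : 'I_m -> R) (eps x : R) :
  (forall i, ~~ (`|x - p i| <= eps)) -> control p beta eps x = 0.
Proof.
by move=> xout; rewrite /control; case: pickP => // i xi; case/negP: (xout i).
Qed.

(** The first entrance of the uncontrolled trajectory is also one of the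
    controlled trajectory, as both agree up to that time. *)
Lemma controlled_enters {R : realType} {m : nat} (f : R * R -> R) (r0 : R)
    (p beta : 'I_m -> R) (eps x0 : R) :
  (exists k i, `|iter k (fun x => f (x, r0)) x0 - p i| <= eps) ->
  exists k i, `|controlled_trajectory f r0 p beta eps x0 k - p i| <= eps.
Proof.
set y := fun k => iter k (fun x => f (x, r0)) x0 => -[k0 [i0 k0i0]].
have hit : exists k, [exists i, `|y k - p i| <= eps].
  by exists k0; apply/fintype.existsP; exists i0.
case: (ex_minnP hit) => k /fintype.existsP[i ki] kmin; exists k, i.
suff same n : (n <= k)%N -> controlled_trajectory f r0 p beta eps x0 n = y n.
  by rewrite same.
elim: n => // n IH nk; rewrite /controlled_trajectory iterS.
rewrite -/(controlled_trajectory f r0 p beta eps x0 n) IH ?(ltnW nk)//.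
rewrite control_out ?addr0// => j; apply/negP => nj.
have /kmin : [exists i, `|y n - p i| <= eps].
  by apply/fintype.existsP; exists j.
by rewrite leqNgt nk.
Qed.

(** * Local contraction *)

(** Near [a], the difference quotients of [g] at [a] have modulus less than
    [c]. *)
Lemma near_contraction {R : realType} (g : R -> R) (a c : R) :
  derivable g a 1 -> `|derive1 g a| < c ->
  \forall x \near a, `|g x - g a| <= c * `|x - a|.
Proof.
move=> g_diff; rewrite derive1E => g_lt.
have : \forall h \near (0 : R)^', `|h^-1 *: (g (h *: 1 + a) - g a)| < c.
  exact: cvgr_norm_lt g_diff _ g_lt.
rewrite near_withinE => /nbhs_ballP[r /= r0 quotient_lt].
apply/nbhs_ballP; exists r => //= x ax.
have [->|xa] := eqVneq x a; first by rewrite !subrr normr0 mulr0.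
have xa0 : 0 < `|x - a| by rewrite normr_gt0 subr_eq0.
have := quotient_lt (x - a); rewrite /= /ball /= add0r normrN subr_eq0.
rewrite [_%:A]mulr1 subrK normrZ normfV mulrC ltr_pdivrMr//.
by rewrite {1}distrC => /(_ ax xa); exact: ltW.
Qed.

Lemma derivable_feedback_map {R : realType} (f : R * R -> R) (r0 q b x : R) :
  differentiable f (x, r0 + b * (x - q)) ->
  derivable (feedback_map f r0 q b) x 1.
Proof.
move=> f_diff; apply/derivable1_diffP.
exact: (@differentiable_comp _ _ _ _ (fun x => (x, r0 + b * (x - q))) f).
Qed.

Lemma feedback_map_center {R : realType} (f : R * R -> R) (r0 q b : R) :
  feedback_map f r0 q b q = f (q, r0).
Proof. by rewrite /feedback_map subrr mulr0 addr0. Qed.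

(** The midpoint between 1 and the largest multiplier is a contraction factor
    common to all the points of the orbit. *)
Lemma contracting_feedback {R : realType} {m : nat} (f : R * R -> R) (r0 : R)
    (p beta : 'I_m -> R) :
  (forall z, differentiable f z) ->
  (forall i, `|derive1 (feedback_map f r0 (p i) (beta i)) (p i)| < 1) ->
  exists2 c : R, 0 <= c < 1 & \forall e \near 0^'+, forall i x,
    `|x - p i| <= e ->
    `|feedback_map f r0 (p i) (beta i) x - f (p i, r0)| <= c * `|x - p i|.
Proof.
move=> f_diff mult_lt1; set F := fun i => feedback_map f r0 (p i) (beta i).
pose M := \big[Num.max/0]_i `|derive1 (F i) (p i)|.
have M0 : 0 <= M by exact: bigmax_ge_id.
have M1 : M < 1 by apply: bigmax_lt => [|i _]; [exact: ltr01|exact: mult_lt1].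
have MF i : `|derive1 (F i) (p i)| <= M by exact: le_bigmax.
exists ((1 + M) / 2); first by apply/andP; split; lra.
apply: filter_forall => i.
have /nbhs_ballP[r /= r0' rball] : \forall x \near p i,
    `|F i x - F i (p i)| <= (1 + M) / 2 * `|x - p i|.
  apply: near_contraction; first exact/derivable_feedback_map/f_diff.
  by apply: le_lt_trans (MF i) _; lra.
near=> e => x xe; rewrite -(feedback_map_center f r0 (p i) (beta i)).
apply: rball; rewrite /ball /= distrC; apply: le_lt_trans xe _.
by near: e; exact: nbhs_right_lt.
Unshelve. all: by end_near. Qed.

(** * Capture by the orbit *)

(** As [c < 1], the image of a window lies in the next one, so the contraction
    applies again at each later step and the distances are at most
    [c ^+ n * eps], [n] steps after the capture. *)
Lemma captured_converges {R : realType} {m : nat} (hm : (0 < m)%N)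
    (g : R -> R) (p : 'I_m -> R) (c eps x0 : R) :
  0 <= c < 1 ->
  (forall i x, `|x - p i| <= eps ->
     `|g x - p (ord_mod hm i.+1)| <= c * `|x - p i|) ->
  (exists k i, `|iter k g x0 - p i| <= eps) ->
  converges_to_orbit hm (fun k => iter k g x0) p.
Proof.
move=> /andP[c0 c1] g_contr [K [i Ki]].
have eps0 : 0 <= eps by apply: le_trans Ki.
have decay n : `|iter (n + K) g x0 - p (ord_mod hm (i + n))| <= c ^+ n * eps.
  elim: n => [|n IH].
    by rewrite addn0 expr0 mul1r (_ : ord_mod hm i = i)//; apply/val_inj/modn_small.
  have -> : ord_mod hm (i + n.+1) = ord_mod hm (ord_mod hm (i + n)).+1.
    by apply: val_inj; rewrite /= -[in RHS]addn1 modnDml addn1 addnS.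
  rewrite exprS -mulrA; apply: le_trans (g_contr _ _ _) _.
    by apply: le_trans IH _; rewrite ler_piMl// exprn_ile1// ltW.
  exact: ler_wpM2l.
(* The phase is [i - K] modulo [m], written without subtracting [K] from [i]. *)
exists (i + K * m.-1)%N; rewrite -(cvg_shiftn K).
apply: (squeeze_cvgr (f := fun=> 0) (h := fun n => c ^+ n * eps)).
- near=> n; rewrite normr_ge0 /=.
  have -> : ord_mod hm (i + K * m.-1 + (n + K)) = ord_mod hm (i + n).
    apply: val_inj => /=.
    have -> : (i + K * m.-1 + (n + K) = K * m + (i + n))%N.
      have := prednK hm; nia.
    by rewrite modnMDl.
  exact: decay.
- exact: cvg_cst.
- rewrite -[X in _ --> X](mul0r eps); apply: cvgMl.
  by apply: cvg_expr; rewrite ger0_norm.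
Unshelve. all: by end_near. Qed.

Theorem proposition1 (R : realType) (f : R * R -> R) (r0 : R) (A B : set R)
    (m : nat) (hm : (0 < m)%N) (p : 'I_m -> R)
    (beta_inf beta_sup beta : 'I_m -> R) (delta : R)
    (f_C1 : continuously_differentiable f)
    (A_strange : strange_attractor (fun x => f (x, r0)) A)
    (B_basin : B = basin_of_attraction (fun x => f (x, r0)) A)
    (A_sub_B : A `<=` B)
    (p_upo : unstable_periodic_orbit hm (fun x => f (x, r0)) p)
    (p_in_A : forall i, A (p i))
    (ergodic : \forall x0 \ae (@lebesgue_measure R), B x0 ->
       forall (i : 'I_m) (U : set R), nbhs (p i) U ->
         exists k, U (iter k (fun x => f (x, r0)) x0))
    (beta_interval : forall i, beta_inf i < beta_sup i)
    (beta_contract : forall i b, beta_inf i < b < beta_sup i ->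
       `|derive1 (feedback_map f r0 (p i) b) (p i)| < 1)
    (beta_in : forall i, beta_inf i < beta i < beta_sup i)
    (delta_gt0 : 0 < delta) :
  exists eps0 : R,
    [/\ 0 < eps0,
        (eps0%:E < radius_bound p delta (max_gain beta))%E
      & forall eps : R, 0 < eps < eps0 ->
          \forall x0 \ae (@lebesgue_measure R), B x0 ->
            (forall k, `|control p beta eps
                           (controlled_trajectory f r0 p beta eps x0 k)|
                         <= delta) /\
            converges_to_orbit hm (controlled_trajectory f r0 p beta eps x0) p].
Proof.
have [[p_inj p_next] _] := p_upo.
have [c c01 c_contr] : exists2 c : R, 0 <= c < 1 & \forall e \near 0^'+,
    forall i x, `|x - p i| <= e ->
    `|feedback_map f r0 (p i) (beta i) x - f (p i, r0)| <= c * `|x - p i|.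
  apply: contracting_feedback => [|i]; first by case: f_C1.
  exact: beta_contract (beta_in i).
have bound0 := radius_bound_gt0 p delta (max_gain beta) p_inj delta_gt0
  (max_gain_ge0 beta).
have [eps0 [eps0_gt0 eps0_lt eps0_contr]] : exists e : R,
    [/\ 0 < e, (e%:E < radius_bound p delta (max_gain beta))%E & forall i x,
    `|x - p i| <= e ->
    `|feedback_map f r0 (p i) (beta i) x - f (p i, r0)| <= c * `|x - p i|].
  near (0 : R)^'+ => e; exists e; split; near: e => //.
    exact: nbhs_right_gt.
  exact: near_right_lt_ereal.
exists eps0; split=> // eps /andP[eps_gt0 eps_lt].
have [eps_sep eps_delta] := lt_radius_bound p delta (max_gain beta) eps
  delta_gt0 (max_gain_ge0 beta) (lt_trans (etrans (lte_fin _ _) eps_lt) eps0_lt).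
apply: (@filterS _ _ (ae_filter_ringOfSetsType _) _ _ _ ergodic) => x0 visits Bx0; split=> [k|].
  exact: le_trans (control_le _ _ _ _ (ltW eps_gt0)) eps_delta.
apply: (captured_converges _ _ _ c eps) => // [i x xi|].
  rewrite (control_in _ _ _ _ i)// p_next.
  exact: eps0_contr (le_trans xi (ltW eps_lt)).
apply: controlled_enters.
have [k k_close] := visits Bx0 (Ordinal hm) _ (nbhsx_ballx _ _ eps_gt0).
by exists k, (Ordinal hm); rewrite distrC ltW.
Unshelve. all: by end_near. Qed.
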